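(* In the setting of the context, let $u\in\mathcal B_R$ and suppose that there is an index $k\in\mathbb N$ and a constant $c(u,k)>0$ such that for any $v\in\mathcal B_R$, $\max_{0\le i\le k}\|\Phi_{t_i}(u)-\Phi_{t_i}(v)\|\ge c(u,k)\|v-u\|$. Suppose also that $\sigma_Z^2:=\mathbb E(\|Z_i\|^2)<\infty$. Let $$E_{\max}(v|Y_0,\ldots,Y_k):=\max_{0\le i\le k}\|\Phi_{t_i}(v)-Y_i\|,\qquad u_{\min}:=\operatorname*{arg\,min}_{v\in\mathcal B_R}E_{\max}(v|Y_0,\ldots,Y_k),$$ where, if there are multiple minima, $u_{\min}$ is any one of them. Then the estimator $u_{\min}$ of the initial position $u$ satisfies $$\mathbb E\left(\left.\|u_{\min}-u\|^2\right|u\right)\le D(u,k)\cdot\sigma_Z^2$$ for some constant $D(u,k)<\infty$. Moreover, the push-forward $\Psi_{t_k}(u_{\min})$ is an estimator of the current position $u(t_k)$ satisfying $$\mathbb E\left(\left.\|\Psi_{t_k}(u_{\min})-u(t_k)\|^2\right|u\right)\le D(u,k)\,e^{2Gt_k}\cdot\sigma_Z^2,$$ where $G=\|A\|+2\|B\|R$.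
   Context: Dynamics: $\frac{du}{dt}=-Au-B(u,u)+f$ on $\mathbb R^d$, with $A$ a linear operator, $B:\mathbb R^d\times\mathbb R^d\to\mathbb R^d$ bilinear, $f\in\mathbb R^d$. For $v\in\mathbb R^d$, $v(t)=\Psi_t(v)$ is the solution with $v(0)=v$. Trapping ball assumption: there are $R,\delta>0$ with $\langle -Av-B(v,v)+f,v\rangle\le0$ whenever $\|v\|\in[R,R+\delta]$. $\mathcal B_R=\{v:\|v\|\le R\}$; for $v\in\mathcal B_R$ the solution exists for all $t\ge0$ and stays in $\mathcal B_R$. $\|A\|$ is the Euclidean operator norm and $\|B\|=\sup_{\|v\|=\|w\|=1}\|B(v,w)\|$. Observations: $t_i=ih$ with fixed $h>0$, $Y_i=Hu(t_i)+Z_i$, $H\in\mathbb R^{d_o\times d}$, $Z_i$ i.i.d. centered random vectors in $\mathbb R^{d_o}$ with a density, true initial point $u$. $\Phi_t(v):=H\Psi_t(v)$. $\mathbb E(\cdot|u)$ is expectation over the noise with fixed $u$. The constant $D(u,k)$ depends, as the notation indicates, on $u$ and $k$ (for the given system, $H$ and $h$), and not on $\sigma_Z$. *)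

(* Defs.v *)
From HB Require Import structures.
From mathcomp Require Import all_boot all_order all_algebra.
From mathcomp Require Import finmap.
From mathcomp Require Import all_classical all_reals all_analysis.

Set Implicit Arguments.
Unset Strict Implicit.
Unset Printing Implicit Defensive.

Import Order.TTheory GRing.Theory Num.Theory.
Import numFieldNormedType.Exports.

Local Open Scope classical_set_scope.
Local Open Scope ring_scope.

(* The library's norm `|v| on matrices is the sup norm (it only provides the
   topology here); the Euclidean structure is defined separately. *)
Section euclidean.
Context {R : realType}.

Definition edot n (v w : 'cV[R]_n) : R := \sum_i v i 0 * w i 0.

Definition enorm n (v : 'cV[R]_n) : R := Num.sqrt (edot v v).

Definition eball n (r : R) : set 'cV[R]_n := [set v | enorm v <= r].

Definition esphere n : set 'cV[R]_n := [set v | enorm v = 1].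

Definition opnorm n (A : 'cV[R]_n -> 'cV[R]_n) : R :=
  sup [set enorm (A v) | v in @esphere n].

Definition bilnorm n (B : 'cV[R]_n -> 'cV[R]_n -> 'cV[R]_n) : R :=
  sup [set enorm (B v w) | v in @esphere n & w in @esphere n].

End euclidean.

Section dynamics.
Context {R : realType} {n : nat}.
Variables (A : 'cV[R]_n -> 'cV[R]_n) (B : 'cV[R]_n -> 'cV[R]_n -> 'cV[R]_n).
Variable f : 'cV[R]_n.

Definition vfield (v : 'cV[R]_n) : 'cV[R]_n := - A v - B v v + f.

Definition trapping_ball (r delta : R) : Prop :=
  forall v : 'cV[R]_n, r <= enorm v <= r + delta -> edot (vfield v) v <= 0.

(* Solution on [0, +oo[; since the right-hand side is continuous, continuity at
   0 also gives the one-sided derivative there. *)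
Definition is_solution (v : 'cV[R]_n) (x : R -> 'cV[R]_n) : Prop :=
  [/\ x 0 = v,
      {within `[0, +oo[, continuous x} &
      forall t : R, 0 < t -> is_derive t 1 x (vfield (x t))].

(* Nothing is required of Psi t v for t < 0 or for v outside the ball, where
   solutions may blow up. *)
Definition is_solution_map (r : R) (Psi : R -> 'cV[R]_n -> 'cV[R]_n) : Prop :=
  forall v : 'cV[R]_n, eball r v -> is_solution v (Psi ^~ v).

End dynamics.

Section observations.
Context {R : realType} {n m : nat}.
Variables (H : 'M[R]_(m, n)) (Psi : R -> 'cV[R]_n -> 'cV[R]_n) (h : R).

Definition obs_time (i : nat) : R := i%:R * h.

Definition Phi (t : R) (v : 'cV[R]_n) : 'cV[R]_m := H *m Psi t v.

(* The neutral element 0 of the maxima below is harmless: all terms are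
   nonnegative. *)
Definition max_obs_dist (k : nat) (u v : 'cV[R]_n) : R :=
  \big[Num.max/0]_(i < k.+1) enorm (Phi (obs_time i) u - Phi (obs_time i) v).

Definition Emax (k : nat) (Y : nat -> 'cV[R]_m) (v : 'cV[R]_n) : R :=
  \big[Num.max/0]_(i < k.+1) enorm (Phi (obs_time i) v - Y i).

End observations.

Definition is_argmin (R : realType) (T : Type) (S : set T) (F : T -> R)
    (x : T) : Prop :=
  S x /\ forall y, S y -> F x <= F y.

(* The Borel (= product) sigma-algebra on column vectors, in the same way as the
   library does for n.-tuple T. *)
Definition measure_cV_display : measure_display -> measure_display.
Proof. exact. Qed.

Section measurable_cV.
Context {d : measure_display} {T : sigmaRingType d}.
Variable n : nat.

Let coors : 'I_n -> 'cV[T]_n -> T := fun i v => v i ord0.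

Let cV_set0 : g_sigma_preimage coors set0.
Proof. exact: sigma_algebra0. Qed.

Let cV_setC A : g_sigma_preimage coors A -> g_sigma_preimage coors (~` A).
Proof. exact: sigma_algebraC. Qed.

Let cV_bigcup (F : _^nat) : (forall i, g_sigma_preimage coors (F i)) ->
  g_sigma_preimage coors (\bigcup_i (F i)).
Proof. exact: sigma_algebra_bigcup. Qed.

HB.instance Definition _ := @isMeasurable.Build (measure_cV_display d)
  'cV[T]_n (g_sigma_preimage coors) cV_set0 cV_setC cV_bigcup.

End measurable_cV.

Lemma measurable_fun_cV d1 d2 (T1 : measurableType d1) (T2 : measurableType d2)
    n (g : T1 -> 'cV[T2]_n) :
  (forall i, measurable_fun [set: T1] (fun x => g x i ord0)) ->
  measurable_fun [set: T1] g.
Proof.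
move=> mg.
suff gS : g_sigma_preimage (fun (i : 'I_n) x => g x i ord0) `<=` measurable.
  move=> _ A mA; rewrite setTI; apply: gS.
  rewrite (g_sigma_preimage_comp (fun (i : 'I_n) (v : 'cV[T2]_n) => v i ord0) g).
  by exists A => //; rewrite setTI.
apply: smallest_sub; first exact: sigma_algebra_measurable.
case: n g mg => [|n] g mg; first by rewrite big_ord0.
rewrite -bigcup_mkord_ord; apply: bigcup_sub => i Ii.
by move=> A [B mB <-]; exact: mg.
Qed.

Lemma measurable_cV_coord d (T : measurableType d) n (i : 'I_n) :
  measurable_fun [set: 'cV[T]_n] (fun v : 'cV[T]_n => v i ord0).
Proof.
move=> _ Y mY; rewrite setTI; apply: sub_sigma_algebra => /=.
rewrite -bigcup_seq/=; exists i => /=; first by rewrite mem_index_enum.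
by exists Y => //; rewrite setTI.
Qed.

Section lebesgue_cV.
Context {R : realType}.

Definition cV_cons n (p : 'cV[R]_n * measurableTypeR R) : 'cV[R]_n.+1 :=
  \col_i oapp (fun j : 'I_n => p.1 j ord0) p.2 (unlift ord0 i).

Lemma measurable_cV_cons n : measurable_fun [set: _] (@cV_cons n).
Proof.
apply: measurable_fun_cV => i.
have [j ->|->] := unliftP ord0 i.
- rewrite (_ : (fun _ => _) = (fun v : 'cV[R]_n => v j ord0) \o fst).
    by apply: measurableT_comp => //; exact: measurable_cV_coord.
  by apply/funext => p /=; rewrite mxE liftK.
- rewrite (_ : (fun _ => _) = snd) //.
  by apply/funext => p /=; rewrite mxE unlift_none.
Qed.

Section extend_measure.
Variables (n : nat) (mu : {measure set 'cV[R]_n -> \bar R}).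
Local Open Scope ereal_scope.

Definition extend_measure : set 'cV[R]_n.+1 -> \bar R :=
  pushforward (mu \x lebesgue_measure) (@cV_cons n).

Let extend_measure0 : extend_measure set0 = 0.
Proof. by rewrite /extend_measure /pushforward preimage_set0 measure0. Qed.

Let extend_measure_ge0 A : 0 <= extend_measure A.
Proof. by rewrite /extend_measure /pushforward measure_ge0. Qed.

Let extend_measure_sigma_additive : semi_sigma_additive extend_measure.
Proof.
move=> F mF tF mUF; rewrite /extend_measure /pushforward preimage_bigcup.
have mcons S : measurable S -> measurable (@cV_cons n @^-1` S).
  by move=> mS; rewrite -[X in measurable X]setTI; exact: measurable_cV_cons.
apply: measure_semi_sigma_additive.
- by move=> i; exact: mcons.
- apply/trivIsetP => /= i j _ _ ij; rewrite -preimage_setI.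
  by move/trivIsetP : tF => /(_ _ _ _ _ ij) ->//; rewrite preimage_set0.
- by rewrite -preimage_bigcup; exact: mcons.
Qed.

HB.instance Definition _ := isMeasure.Build _ _ _ extend_measure
  extend_measure0 extend_measure_ge0 extend_measure_sigma_additive.

End extend_measure.

(* Lebesgue measure on R^n, as the n-fold product of the one on R. *)
Fixpoint lebesgue_cV n : {measure set 'cV[R]_n -> \bar R} :=
  match n with
  | 0 => dirac (0 : 'cV[R]_0)
  | n'.+1 => extend_measure (lebesgue_cV n')
  end.

End lebesgue_cV.

Section random_vectors.
Context {d : measure_display} {T : measurableType d} {R : realType}.
Variables (P : probability T R) (m : nat).
Implicit Types (X : {RV P >-> 'cV[R]_m}) (Z : nat -> {RV P >-> 'cV[R]_m}).

Local Open Scope ereal_scope.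

Definition has_density X : Prop :=
  exists p : 'cV[R]_m -> R,
    [/\ measurable_fun [set: 'cV[R]_m] p,
        forall z, (0 <= p z)%R &
        forall S : set 'cV[R]_m, measurable S ->
          distribution P X S = \int[lebesgue_cV m]_(z in S) (p z)%:E].

Definition centered X : Prop :=
  forall j : 'I_m, P.-integrable [set: T] (fun w => (X w j ord0)%:E) /\
    'E_P[fun w => X w j ord0] = 0.

Definition mutually_independent Z : Prop :=
  forall (J : {fset nat}) (S : nat -> set 'cV[R]_m),
    (forall i, measurable (S i)) ->
    P (\bigcap_(i in [set` J]) Z i @^-1` S i) =
    \prod_(i <- J) P (Z i @^-1` S i).

Definition identically_distributed Z : Prop :=
  forall (i j : nat) (S : set 'cV[R]_m), measurable S ->
    distribution P (Z i) S = distribution P (Z j) S.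

End random_vectors.

(* Main.v *)
Require Import Defs.
From mathcomp Require Import all_boot all_order all_algebra.
From mathcomp Require Import all_classical all_reals all_analysis.
From mathcomp Require Import measurable_realfun.
From mathcomp Require Import ring lra.

(** The estimate is deterministic up to its last step. The minimizer [umin]
    fits the data no worse than the true initial point [u], whose misfit is
    exactly the noise; by the triangle inequality the noiseless observations of
    [umin] and [u] therefore differ by at most twice the largest noise vector
    ([max_obs_dist_argmin]). The observability hypothesis turns this into
    [c * enorm (umin - u) <= 2 * max_i enorm (Z i)], and bounding the square of
    a maximum by the sum of the squares gives
    [enorm (umin - u) ^+ 2 <= 4 / c ^+ 2 * \sum_i enorm (Z i) ^+ 2]
    ([sqr_error_le]). Taking expectations yields the first bound with
    [D = 4 * (k + 1) / c ^+ 2].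

    For the current position, the flow is Lipschitz on the ball. Solutions
    starting in the ball stay there because the field does not point outwards
    in a shell around it ([trapping_ball_stable]). For two solutions in the
    ball, with difference [d], bilinearity gives
    [B v v - B w w = B d v + B w d], so that the derivative of [edot d d] is
    at most [2 * G * edot d d] with [G = opnorm A + 2 * bilnorm B * r], and
    Gronwall's inequality gives the factor [expR (2 * G * t)]
    ([flow_lipschitz]). Multiplying the pointwise error bound by this factor
    before taking expectations gives the second bound with the same [D].

    A minimizer is selected separately for each outcome, and this selection
    need not be measurable: expectations of errors are lower integrals, which
    are still monotone ([ge0_expectation_le]). *)

Set Implicit Arguments.
Unset Strict Implicit.
Unset Printing Implicit Defensive.

Import Order.TTheory GRing.Theory Num.Theory.
Import numFieldNormedType.Exports.

Local Open Scope classical_set_scope.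
Local Open Scope ring_scope.

(** * Euclidean geometry of column vectors *)

Section euclidean_norm.
Context {R : realType}.

Lemma edotC n (v w : 'cV[R]_n) : edot v w = edot w v.
Proof. by apply: eq_bigr => i _; rewrite mulrC. Qed.

Lemma edotDl n (v w z : 'cV[R]_n) : edot (v + w) z = edot v z + edot w z.
Proof. by rewrite -big_split; apply: eq_bigr => i _; rewrite mxE mulrDl. Qed.

Lemma edotZl n a (v z : 'cV[R]_n) : edot (a *: v) z = a * edot v z.
Proof. by rewrite /edot mulr_sumr; apply: eq_bigr => i _; rewrite mxE mulrA. Qed.

Lemma edotNl n (v z : 'cV[R]_n) : edot (- v) z = - edot v z.
Proof. by rewrite -scaleN1r edotZl mulN1r. Qed.

Lemma edotDr n (v w z : 'cV[R]_n) : edot z (v + w) = edot z v + edot z w.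
Proof. by rewrite edotC edotDl !(edotC z). Qed.

Lemma edotZr n a (v z : 'cV[R]_n) : edot z (a *: v) = a * edot z v.
Proof. by rewrite edotC edotZl edotC. Qed.

Lemma edotNr n (v z : 'cV[R]_n) : edot z (- v) = - edot z v.
Proof. by rewrite edotC edotNl edotC. Qed.

Lemma edot_ge0 n (v : 'cV[R]_n) : 0 <= edot v v.
Proof. by apply: sumr_ge0 => i _; rewrite -expr2 sqr_ge0. Qed.

Lemma sqr_enorm n (v : 'cV[R]_n) : enorm v ^+ 2 = edot v v.
Proof. by rewrite sqr_sqrtr ?edot_ge0. Qed.

Lemma enorm_ge0 n (v : 'cV[R]_n) : 0 <= enorm v.
Proof. exact: sqrtr_ge0. Qed.

Lemma le_coord_enorm n (v : 'cV[R]_n) i : `|v i 0| <= enorm v.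
Proof.
rewrite -[leLHS]sqrtr_sqr ler_sqrt ?edot_ge0// /edot (bigD1 i)//= -expr2.
by rewrite lerDl sumr_ge0// => j _; rewrite -expr2 sqr_ge0.
Qed.

Lemma enorm_eq0 n (v : 'cV[R]_n) : enorm v = 0 -> v = 0.
Proof.
move=> v0; apply/matrixP => i j; rewrite (ord1 j) mxE; apply/eqP.
by rewrite -normr_le0 -v0 le_coord_enorm.
Qed.

Lemma enormZ n a (v : 'cV[R]_n) : enorm (a *: v) = `|a| * enorm v.
Proof.
by rewrite /enorm edotZl edotZr mulrA -expr2 sqrtrM ?sqr_ge0// sqrtr_sqr.
Qed.

Lemma enormN n (v : 'cV[R]_n) : enorm (- v) = enorm v.
Proof. by rewrite -scaleN1r enormZ normrN1 mul1r. Qed.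

Lemma enorm0 n : enorm (0 : 'cV[R]_n) = 0.
Proof. by rewrite -(scale0r 0) enormZ normr0 mul0r. Qed.

(** Cauchy-Schwarz, from the nonnegativity of the square of
    [enorm w *: v - enorm v *: w]. *)
Lemma edot_le_enorm n (v w : 'cV[R]_n) : edot v w <= enorm v * enorm w.
Proof.
have [/enorm_eq0 ->|v0] := eqVneq (enorm v) 0.
  by rewrite -(scale0r 0) edotZl mul0r mulr_ge0 ?enorm_ge0.
have [/enorm_eq0 ->|w0] := eqVneq (enorm w) 0.
  by rewrite -(scale0r 0) edotZr mul0r mulr_ge0 ?enorm_ge0.
have vw_gt0 : 0 < enorm v * enorm w.
  by rewrite mulr_gt0// lt_neqAle eq_sym ?v0 ?w0 enorm_ge0.
have := edot_ge0 (enorm w *: v + - (enorm v *: w)).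
rewrite edotDl !edotDr !edotNl !edotNr !edotZl !edotZr (edotC w v) -!sqr_enorm.
move=> h; rewrite -(ler_pM2l vw_gt0); lra.
Qed.

Lemma enormD n (v w : 'cV[R]_n) : enorm (v + w) <= enorm v + enorm w.
Proof.
rewrite -(@ler_pXn2r _ 2)// ?nnegrE ?addr_ge0 ?enorm_ge0//.
rewrite sqr_enorm edotDl !edotDr (edotC w v) -!sqr_enorm sqrrD.
by have := edot_le_enorm v w; lra.
Qed.

Lemma enormB_le n (v w : 'cV[R]_n) : enorm (v - w) <= enorm v + enorm w.
Proof. by rewrite -(enormN w) enormD. Qed.

Lemma enorm_sum n (I : finType) (F : I -> 'cV[R]_n) :
  enorm (\sum_i F i) <= \sum_i enorm (F i).
Proof.
elim/big_ind2 : _ => [|x a y b ax by_|//]; first by rewrite enorm0.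
exact: le_trans (enormD _ _) (lerD _ _).
Qed.

Lemma cV_sum_delta n (v : 'cV[R]_n) : v = \sum_i v i 0 *: delta_mx i 0.
Proof. by rewrite [LHS]matrix_sum_delta; apply: eq_bigr => i _; rewrite big_ord1. Qed.

Lemma enorm_polar n (v : 'cV[R]_n) :
  v != 0 -> exists2 s, esphere s & v = enorm v *: s.
Proof.
move=> v0; have nv0 : enorm v != 0.
  by apply: contra v0 => /eqP/enorm_eq0 ->.
exists ((enorm v)^-1 *: v); last by rewrite scalerA mulfV// scale1r.
by rewrite /esphere/= enormZ ger0_norm ?invr_ge0 ?enorm_ge0// mulVf.
Qed.

(** The supremum defining the operator norm is only meaningful once the image
    of the sphere is known to be bounded; summing over the standard basis
    provides a bound. *)
Lemma le_opnorm n (A : {linear 'cV[R]_n -> 'cV[R]_n}) v :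
  enorm (A v) <= opnorm A * enorm v.
Proof.
have [->|/enorm_polar[s s1 vE]] := eqVneq v 0.
  by rewrite linear0 enorm0 mulr0.
rewrite {1}vE linearZ enormZ ger0_norm ?enorm_ge0// mulrC.
rewrite ler_wpM2r ?enorm_ge0//; apply: ub_le_sup; last by exists s.
exists (\sum_i enorm (A (delta_mx i 0))) => _ [w w1 <-].
rewrite {1}(cV_sum_delta w) linear_sum (le_trans (enorm_sum _))//.
apply: ler_sum => i _; rewrite linearZ enormZ ler_piMl ?enorm_ge0//.
by rewrite -w1 le_coord_enorm.
Qed.

Lemma le_bilnorm n (B : {bilinear 'cV[R]_n -> 'cV[R]_n -> 'cV[R]_n}) v w :
  enorm (B v w) <= bilnorm B * enorm v * enorm w.
Proof.
have [->|/enorm_polar[s s1 vE]] := eqVneq v 0.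
  by rewrite linear0l !enorm0 mulr0 mul0r.
have [->|/enorm_polar[t t1 wE]] := eqVneq w 0.
  by rewrite linear0r !enorm0 mulr0.
rewrite {1}vE {1}wE linearZl_LR linearZr_LR !enormZ !ger0_norm ?enorm_ge0//.
rewrite mulrA mulrC mulrA ler_wpM2r ?enorm_ge0// ler_wpM2r ?enorm_ge0//.
apply: ub_le_sup; last by exists s => //; exists t.
exists (\sum_i \sum_j enorm (B (delta_mx i 0) (delta_mx j 0))).
move=> _ [a a1 [b b1 <-]].
rewrite {1}(cV_sum_delta a) linear_sumlz (le_trans (enorm_sum _))//.
apply: ler_sum => i _; rewrite {1}(cV_sum_delta b) linear_sumr.
rewrite (le_trans (enorm_sum _))//; apply: ler_sum => j _.
rewrite linearZl_LR linearZr_LR !enormZ mulrA ler_piMl ?enorm_ge0//.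
apply: mulr_ile1 => //; first by rewrite -a1 le_coord_enorm.
by rewrite -b1 le_coord_enorm.
Qed.

End euclidean_norm.

(** * Scalar differential inequalities on the half-line *)

Section scalar_barriers.
Context {R : realType}.

Lemma within_cy_dist (g : R -> R) (s e : R) :
  {within `[0, +oo[, continuous g} -> 0 <= s -> 0 < e ->
  exists2 d, 0 < d & forall t, 0 <= t -> `|s - t| < d -> `|g s - g t| < e.
Proof.
move=> cg s0 e0.
have /cvgrPdist_lt/(_ e e0) : g t @[t --> within `[0, +oo[ (nbhs s)] --> g s.
  by move/subspace_continuousP : cg; apply; rewrite /= in_itv/= andbT.
rewrite near_withinE => /nbhs_ballP[d /= d0 dg]; exists d => // t t0 st.
by apply: dg => //=; rewrite in_itv/= andbT.
Qed.

(** A function that does not increase while its values lie in the shell between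
    [a] and [b] cannot climb above [a]: after the last time at which it is at
    most [a], it would spend some time inside the shell, hence be nonincreasing
    there. The shell has positive thickness, which is what makes a weak
    inequality on the derivative sufficient. *)
Lemma le_barrier (g dg : R -> R) (a b : R) :
  {within `[0, +oo[, continuous g} ->
  (forall t : R, 0 < t -> is_derive t 1 g (dg t)) ->
  a < b -> g 0 <= a ->
  (forall t : R, 0 < t -> a <= g t <= b -> dg t <= 0) ->
  forall t, 0 <= t -> g t <= a.
Proof.
move=> cg g' ab g0 dg0 t1 t10; apply: contrapT => /negP; rewrite -ltNge => gt1.
(* sup S is the last time before t1 at which g is at most a *)
pose S := [set t | 0 <= t <= t1 /\ g t <= a].
have ubS : ubound S t1 by move=> t [/andP[]].
have S0 : S 0 by split => //; rewrite lexx.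
have supS : has_sup S by split; [exists 0|exists t1].
have s0 : 0 <= sup S by apply: ub_le_sup => //; exists t1.
have st1 : sup S <= t1 by apply: ge_sup => //; exists 0.
have gs : g (sup S) <= a.
  rewrite leNgt; apply/negP => gs.
  have [d d0 gd] := within_cy_dist cg s0 (ltac:(by rewrite subr_gt0) : 0 < g (sup S) - a).
  have [e [/andP[e0 et1] ge] es] := sup_adherent d0 supS.
  have es' : e <= sup S by apply: ub_le_sup; [exists t1|split => //; rewrite e0].
  have := gd e e0; rewrite ger0_norm ?subr_ge0// => /(_ _)/ltr_normlW; lra.
have lt_st1 : sup S < t1.
  by rewrite lt_neqAle st1 andbT; apply: contraTneq gt1 => <-; rewrite -leNgt.
have [d d0 gd] := within_cy_dist cg s0 (ltac:(by rewrite subr_gt0) : 0 < b - a).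
(* g still lies below b on the interval from sup S to t2 *)
pose t2 := Num.min t1 (sup S + d / 2).
have st2 : sup S < t2 by rewrite lt_min lt_st1/= ltrDl divr_gt0.
have t21 : t2 <= t1 by rewrite ge_min lexx.
have t2d : t2 <= sup S + d / 2 by rewrite ge_min lexx orbT.
have ga t : sup S < t -> t <= t2 -> a < g t.
  move=> st tt2; rewrite ltNge; apply/negP => gta.
  suff : t <= sup S by rewrite leNgt st.
  apply: ub_le_sup; first by exists t1.
  by split => //; rewrite (le_trans s0 (ltW st)) (le_trans tt2).
have gb t : sup S < t -> t <= t2 -> g t <= b.
  move=> st tt2; have := gd t (le_trans s0 (ltW st)).
  rewrite distrC gtr0_norm ?subr_gt0// => h; have := h ltac:(lra).
  by rewrite ltr_distlC => /andP[_]; lra.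
suff : g t2 <= g (sup S) by have := ga t2 st2 (lexx _); lra.
apply: (@ler0_derive1_nincr _ g (sup S) t2) => //; last exact: ltW.
- by move=> t; rewrite in_itv/= => /andP[st _]; have := g' t (le_lt_trans s0 st); case.
- move=> t; rewrite in_itv/= => /andP[st tt2].
  have t0 := le_lt_trans s0 st.
  rewrite derive1E; have -> := @derive_val _ _ _ _ _ _ _ (g' t t0).
  by rewrite dg0 // (ltW (ga _ _ _)) ?gb ?ltW.
- apply: continuous_subspaceW cg => t /=; rewrite !in_itv/= andbT.
  by move=> /andP[st _]; exact: le_trans st.
Qed.

(** The hypothesis says that [expR (- c * t) * g t] is nonincreasing. *)
Lemma gronwall_le (g dg : R -> R) (c : R) :
  {within `[0, +oo[, continuous g} ->
  (forall t : R, 0 < t -> is_derive t 1 g (dg t)) ->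
  (forall t : R, 0 < t -> dg t <= c * g t) ->
  forall t, 0 <= t -> g t <= expR (c * t) * g 0.
Proof.
move=> cg g' dgc t t0.
pose F t := expR (- c * t) * g t.
have F' (s : R) : 0 < s -> is_derive s 1 F (expR (- c * s) * (dg s - c * g s)).
  move=> s0; have := g' s s0 => gs.
  have es : is_derive s 1 (fun s => expR (- c * s)) (expR (- c * s) * - c).
    apply: (@is_derive1_comp _ expR ( *%R (- c))).
    by apply: is_derive_eq; rewrite /GRing.scale/= mulr1.
  apply: is_derive_eq; rewrite /GRing.scale/=; ring.
suff : F t <= F 0.
  rewrite /F mulr0 expR0 mul1r mulNr expRN => Ft.
  by rewrite mulrC -ler_pdivrMr ?expR_gt0// mulrC.
apply: (@ler0_derive1_nincry _ F 0) => //.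
- by move=> s; rewrite in_itv/= andbT => /F'[].
- move=> s; rewrite in_itv/= andbT => s0.
  rewrite derive1E; have -> := @derive_val _ _ _ _ _ _ _ (F' s s0).
  by rewrite mulr_ge0_le0 ?expR_ge0// subr_le0 dgc.
- apply/subspace_continuousP => s s0; apply: cvgM; last first.
    by move/subspace_continuousP : cg; exact.
  apply: cvg_within_filter; apply: (@continuous_comp _ _ _ ( *%R (- c)) expR).
    exact: mulrl_continuous.
  exact: continuous_expR.
Qed.

End scalar_barriers.

(** * Stability of the flow on the trapping ball *)

Section flow.
Context {R : realType} {n : nat}.
Variables (A : {linear 'cV[R]_n -> 'cV[R]_n}).
Variable (B : {bilinear 'cV[R]_n -> 'cV[R]_n -> 'cV[R]_n}).
Variable f : 'cV[R]_n.
Implicit Types (x y : R -> 'cV[R]_n).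

Lemma is_derive_edot x dx (t : R) : is_derive t 1 x dx ->
  is_derive t 1 (fun s => edot (x s) (x s)) (2 * edot dx (x t)).
Proof.
move=> x'.
have xi i : is_derive t 1 (fun s => x s i 0) (dx i 0).
  have x1 : derivable x t 1 by case: x'.
  apply: DeriveDef; first exact: (derivable_mxP x t 1).1.
  by have := derive_mx x1; rewrite (@derive_val _ _ _ _ _ _ _ x') => ->; rewrite mxE.
rewrite (_ : (fun _ => _) = \sum_i (fun s => x s i 0) * (fun s => x s i 0)); last first.
  by apply/funext => s; rewrite fct_sumE.
apply: is_derive_eq; rewrite /edot mulr_sumr; apply: eq_bigr => i _.
rewrite /GRing.scale/=; ring.
Qed.

Lemma within_continuous_edot x (D : set R) : {within D, continuous x} ->
  {within D, continuous (fun s => edot (x s) (x s))}.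
Proof.
move=> cx; apply: (@within_continuous_comp _ _ _ D x (fun v => edot v v)) => //.
move=> v _; apply: (@cvg_big _ _ _ _ _ _ _ (nbhs v)) => [|i _]; first exact: add_continuous.
by apply: cvgM; exact: coord_continuous.
Qed.

(** The squared norm of a solution has derivative twice
    [edot (vfield _) _], so the trapping inequality on the shell is the
    hypothesis of the barrier lemma. *)
Lemma trapping_ball_stable r delta v x : 0 <= r -> 0 < delta ->
  trapping_ball A B f r delta -> is_solution A B f v x -> eball r v ->
  forall t, 0 <= t -> eball r (x t).
Proof.
move=> r0 delta0 trap [x0 cx x'] vr t t0.
rewrite /eball/= -(@ler_pXn2r _ 2) ?nnegrE ?enorm_ge0// sqr_enorm.
apply: (le_barrier (within_continuous_edot cx)
  (fun s s0 => is_derive_edot (x' s s0)) (b := (r + delta) ^+ 2)) => //.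
- by rewrite ltrXn2r ?ltrDl// ?nnegrE ?addr_ge0// ltW.
- by rewrite x0 -sqr_enorm ler_pXn2r ?nnegrE ?enorm_ge0.
- move=> s s0; rewrite -sqr_enorm !ler_pXn2r ?nnegrE ?enorm_ge0 ?addr_ge0 ?(ltW delta0)//.
  by move=> /trap; rewrite pmulr_rle0.
Qed.

(** Comparing [B v v] and [B w w] through [B w v] writes their difference with
    [v - w] in one of the two arguments. *)
Lemma vfieldB v w : vfield A B f v - vfield A B f w =
  - (A (v - w) + (B (v - w) v + B w (v - w))).
Proof.
rewrite /vfield linearB linearBl linearBr.
rewrite opprD addrACA subrr addr0 !opprD !opprK.
by rewrite [RHS]addrA [LHS]addrACA -!addrA; do ?congr (_ + _); rewrite addrCA addKr.
Qed.

(** A one-sided Lipschitz bound on the ball, which is where quadratic growth is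
    controlled: each of the two terms of the difference of the quadratic parts
    has an argument of norm at most [r]. *)
Lemma edot_vfieldB_le r v w : eball r v -> eball r w ->
  edot (vfield A B f v - vfield A B f w) (v - w) <=
  (opnorm A + 2 * bilnorm B * r) * edot (v - w) (v - w).
Proof.
rewrite /eball/= => vr wr; rewrite vfieldB -sqr_enorm.
apply: le_trans (edot_le_enorm _ _) _.
rewrite expr2 mulrA ler_wpM2r ?enorm_ge0// enormN.
apply: le_trans (enormD _ _) _; rewrite mulrDl lerD ?le_opnorm//.
apply: le_trans (enormD _ _) _.
have := le_bilnorm B (v - w) v; have := le_bilnorm B w (v - w).
have b0 : 0 <= bilnorm B * enorm (v - w) * enorm (v - w).
  exact: le_trans (enorm_ge0 _) (le_bilnorm _ _ _).
have [d0|d0] := eqVneq (enorm (v - w)) 0.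
  by rewrite d0 !(mulr0, mul0r); lra.
have d_gt0 : 0 < enorm (v - w) by rewrite lt_neqAle eq_sym d0 enorm_ge0.
have {}b0 : 0 <= bilnorm B * enorm (v - w) by rewrite -(pmulr_lge0 _ d_gt0).
have := ler_wpM2l b0 vr; have := ler_wpM2l b0 wr; lra.
Qed.

Lemma flow_lipschitz r delta (Psi : R -> 'cV[R]_n -> 'cV[R]_n) u v t :
  0 <= r -> 0 < delta -> trapping_ball A B f r delta ->
  is_solution_map A B f r Psi -> eball r u -> eball r v -> 0 <= t ->
  enorm (Psi t v - Psi t u) ^+ 2 <=
  expR (2 * (opnorm A + 2 * bilnorm B * r) * t) * enorm (v - u) ^+ 2.
Proof.
move=> r0 delta0 trap sol ur vr t0.
have [u0 cu u'] := sol u ur; have [v0 cv v'] := sol v vr.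
have uB := trapping_ball_stable r0 delta0 trap (sol u ur) ur.
have vB := trapping_ball_stable r0 delta0 trap (sol v vr) vr.
rewrite !sqr_enorm -[in leRHS]v0 -[in leRHS]u0.
apply: (gronwall_le (within_continuous_edot (within_continuousB cv cu))
  (fun s s0 => is_derive_edot (is_deriveB (v' s s0) (u' s s0)))) => // s s0.
rewrite -mulrA ler_pM2l//.
by apply: edot_vfieldB_le; [exact/vB/ltW|exact/uB/ltW].
Qed.

End flow.

(** * Pointwise error of the minimizer *)

Section estimator.
Context {R : realType} {n m : nat}.
Variables (H : 'M[R]_(m, n)) (Psi : R -> 'cV[R]_n -> 'cV[R]_n) (h : R).

(** The minimizer fits the data at least as well as the true initial point,
    whose misfit is the noise; the triangle inequality then bounds the
    distance between the two noiseless observations by twice the noise. *)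
Lemma max_obs_dist_argmin (S : set 'cV[R]_n) k (u umin : 'cV[R]_n)
    (z : nat -> 'cV[R]_m) : S u ->
  is_argmin S (Emax H Psi h k (fun i => Phi H Psi (obs_time h i) u + z i)) umin ->
  max_obs_dist H Psi h k u umin <= 2 * \big[Num.max/0]_(i < k.+1) enorm (z i).
Proof.
move=> Su [_ /(_ _ Su) min_le].
have z_le (i : 'I_k.+1) : enorm (z i) <= \big[Num.max/0]_(i < k.+1) enorm (z i).
  exact: (le_bigmax (0 : R) (fun i : 'I_k.+1 => enorm (z i)) i).
have z0 : 0 <= \big[Num.max/0]_(i < k.+1) enorm (z i).
  exact: le_trans (enorm_ge0 _) (z_le ord0).
apply: bigmax_le => [|i _]; first by rewrite mulr_ge0.
set p := Phi _ _ _ u; set q := Phi _ _ _ umin.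
rewrite (_ : p - q = - (q - (p + z i)) - z i); last first.
  by rewrite opprB addrAC addrK.
apply: le_trans (enormB_le _ _) _; rewrite enormN mulrDl mul1r lerD//.
apply: le_trans (_ : Emax H Psi h k (fun i => Phi H Psi (obs_time h i) u + z i) umin <= _).
  exact: (le_bigmax (0 : R) (fun i : 'I_k.+1 =>
    enorm (Phi H Psi (obs_time h i) umin - (Phi H Psi (obs_time h i) u + z i))) i).
apply: le_trans min_le _; apply: bigmax_le => // j _.
by rewrite opprD addrA subrr add0r enormN.
Qed.

Lemma sqr_bigmax_le k (F : 'I_k -> R) : (forall i, 0 <= F i) ->
  (\big[Num.max/0]_(i < k) F i) ^+ 2 <= \sum_(i < k) F i ^+ 2.
Proof.
move=> F0; have S0 : 0 <= \sum_(i < k) F i ^+ 2.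
  by apply: sumr_ge0 => i _; rewrite sqr_ge0.
rewrite -[leRHS]sqr_sqrtr// ler_pXn2r ?nnegrE ?sqrtr_ge0//; last first.
  by apply/bigmax_geP; left.
apply: bigmax_le => [|i _]; first exact: sqrtr_ge0.
rewrite -[leLHS]ger0_norm// -sqrtr_sqr ler_sqrt// (bigD1 i)//= lerDl.
by apply: sumr_ge0 => j _; rewrite sqr_ge0.
Qed.

(** The square of the maximum is replaced by the sum of squares because the
    expectation of the latter is explicit. *)
Lemma sqr_error_le (S : set 'cV[R]_n) k c (u umin : 'cV[R]_n)
    (z : nat -> 'cV[R]_m) : 0 < c -> S u ->
  (forall v, S v -> c * enorm (v - u) <= max_obs_dist H Psi h k u v) ->
  is_argmin S (Emax H Psi h k (fun i => Phi H Psi (obs_time h i) u + z i)) umin ->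
  enorm (umin - u) ^+ 2 <= 4 / c ^+ 2 * \sum_(i < k.+1) enorm (z i) ^+ 2.
Proof.
move=> c0 Su sep min; have [Smin _] := min.
have le_z := le_trans (sep _ Smin) (max_obs_dist_argmin Su min).
rewrite mulrAC ler_pdivlMr ?exprn_gt0// mulrC -exprMn.
apply: le_trans (_ : (2 * \big[Num.max/0]_(i < k.+1) enorm (z i)) ^+ 2 <= _).
  have l0 : 0 <= c * enorm (umin - u) by rewrite mulr_ge0 ?enorm_ge0 ?ltW.
  by rewrite ler_pXn2r// ?nnegrE// (le_trans l0).
rewrite exprMn -natrX ler_wpM2l//; apply: sqr_bigmax_le => i.
exact: enorm_ge0.
Qed.

End estimator.

(** * Expectations *)

Section expectation.
Context {d : measure_display} {T : measurableType d} {R : realType}.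
Variable P : probability T R.
Local Open Scope ereal_scope.

(** The integral of a nonnegative function is a supremum over the simple
    functions below it, so it is monotone without any measurability. This
    matters because the choice of a minimizer need not be measurable. *)
Lemma ge0_expectation_le (X Y : T -> R) :
  (forall w, 0 <= X w)%R -> (forall w, X w <= Y w)%R -> 'E_P[X] <= 'E_P[Y].
Proof.
move=> X0 XY; rewrite unlock !ge0_integralTE.
- apply: le_ereal_sup => _ [g gX <-]; exists g => // w.
  by apply: le_trans (gX w) _; rewrite lee_fin.
- by move=> w; rewrite lee_fin (le_trans (X0 w)).
- by move=> w; rewrite lee_fin.
Qed.

Lemma measurable_sqr_enorm m (Z : {RV P >-> 'cV[R]_m}) :
  measurable_fun [set: T] (fun w => enorm (Z w) ^+ 2)%R.
Proof.
under eq_fun do rewrite sqr_enorm.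
apply: measurable_sum => i; apply: measurable_funM;
  exact: (measurableT_comp (measurable_cV_coord i)).
Qed.

Lemma expectation_noise_energy m k (Z : nat -> {RV P >-> 'cV[R]_m}) (s C : R) :
  (0 <= C)%R ->
  (forall i, 'E_P[fun w => (enorm (Z i w) ^+ 2)%R] = (s ^+ 2)%:E) ->
  'E_P[fun w => (C * \sum_(i < k.+1) enorm (Z i w) ^+ 2)%R] =
  (C * k.+1%:R * s ^+ 2)%:E.
Proof.
move=> C0 EZ; rewrite unlock.
under eq_integral do rewrite EFinM -sumEFin.
have mZ i : measurable_fun [set: T] (fun w => (enorm (Z i w) ^+ 2)%:E).
  exact/measurable_EFinP/measurable_sqr_enorm.
rewrite ge0_integralZl//; last 2 first.
- exact: emeasurable_sum.
- by move=> w _; apply: sume_ge0 => i _; rewrite lee_fin sqr_ge0.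
rewrite ge0_integral_sum//; last by move=> i w _; rewrite lee_fin sqr_ge0.
under eq_bigr => i _ do (have := EZ i; rewrite unlock => ->).
by rewrite sumEFin sumr_const card_ord -EFinM -(mulr_natl (s ^+ 2)%R) mulrA.
Qed.

End expectation.

(** * The estimation bounds *)

Theorem theorem4p2 (R : realType) (n m : nat)
    (A : {linear 'cV[R]_n -> 'cV[R]_n})
    (B : {bilinear 'cV[R]_n -> 'cV[R]_n -> 'cV[R]_n})
    (f : 'cV[R]_n) (r delta : R) (H : 'M[R]_(m, n)) (h : R)
    (Psi : R -> 'cV[R]_n -> 'cV[R]_n) (u : 'cV[R]_n) (k : nat) :
  0 < r -> 0 < delta -> trapping_ball A B f r delta ->
  is_solution_map A B f r Psi ->
  0 < h ->
  eball r u ->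
  (exists2 c : R, 0 < c &
    forall v, eball r v -> c * enorm (v - u) <= max_obs_dist H Psi h k u v) ->
  exists D : R,
    forall (d : measure_display) (T : measurableType d) (P : probability T R)
      (Z : nat -> {RV P >-> 'cV[R]_m}) (sigmaZ : R) (umin : T -> 'cV[R]_n),
    mutually_independent Z ->
    identically_distributed Z ->
    (forall i, centered (Z i)) ->
    (forall i, has_density (Z i)) ->
    (forall i, 'E_P[fun w => (enorm (Z i w) ^+ 2)%R] = (sigmaZ ^+ 2)%:E)%E ->
    (forall w, is_argmin (eball r)
      (Emax H Psi h k (fun i => Phi H Psi (obs_time h i) u + Z i w)) (umin w)) ->
    ('E_P[fun w => (enorm (umin w - u) ^+ 2)%R] <= (D * sigmaZ ^+ 2)%:E)%E /\
    ('E_P[fun w => (enorm (Psi (obs_time h k) (umin w) - Psi (obs_time h k) u) ^+ 2)%R]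
      <= (D * expR (2 * (opnorm A + 2 * bilnorm B * r) * obs_time h k)
            * sigmaZ ^+ 2)%:E)%E.
Proof.
move=> r0 delta0 trap sol h0 ur [c c0 sep].
exists (4 / c ^+ 2 * k.+1%:R) => d T P Z sigmaZ umin _ _ _ _ EZ min.
have C0 : 0 <= 4 / c ^+ 2 by rewrite divr_ge0 ?exprn_ge0 ?ltW.
have err w : enorm (umin w - u) ^+ 2 <=
    4 / c ^+ 2 * \sum_(i < k.+1) enorm (Z i w) ^+ 2.
  exact: sqr_error_le c0 ur sep (min w).
split.
  rewrite -(expectation_noise_energy k C0 EZ); apply: ge0_expectation_le => w.
    exact: sqr_ge0.
  exact: err.
set L := expR _; have LC0 : 0 <= L * (4 / c ^+ 2) by rewrite mulr_ge0 ?expR_ge0.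
rewrite (mulrC (4 / c ^+ 2 * _) L) (mulrA L).
rewrite -(expectation_noise_energy k LC0 EZ).
apply: ge0_expectation_le => w; first exact: sqr_ge0.
have [minr _] := min w.
have t0 : 0 <= obs_time h k by rewrite mulr_ge0// ltW.
apply: le_trans (flow_lipschitz (ltW r0) delta0 trap sol ur minr t0) _.
by rewrite -(mulrA L) ler_wpM2l ?expR_ge0.
Qed.
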